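(* Let $\lambda>-1/2$, $\eta\in\mathbb R$, $b=\lambda+\mathrm i\eta$, and $\nu(z)=(-z)^{-\overline b}(1-z)^{b+\overline b}$ on $\mathbb T$. Then for every $n\in\mathbb N$ (the identities for $G_n,G_{n-1}^*$ being for $z\notin\mathbb T$): $$z(1-z)\Phi_n'(z)=\big(-nz+(\overline b+n)(1-|\alpha_{n-1}|^2)\big)\Phi_n(z)+(\overline b+n)(1-|\alpha_{n-1}|^2)\overline{\alpha}_{n-1}\Phi_{n-1}^*(z),$$ $$z(1-z)G_n'(z)=\big(-bz-(\overline b+n)|\alpha_{n-1}|^2\big)G_n(z)+(\overline b+n)(1-|\alpha_{n-1}|^2)\overline{\alpha}_{n-1}G_{n-1}^*(z),$$ $$z(1-z)(\Phi_{n-1}^* )'(z)=\big(bz+(\overline b+n)|\alpha_{n-1}|^2\big)\Phi_{n-1}^*(z)+(\overline b+n)\alpha_{n-1}\Phi_n(z),$$ $$z(1-z)(G_{n-1}^* )'(z)=\big(nz-(\overline b+n)(1-|\alpha_{n-1}|^2)\big)G_{n-1}^*(z)+(\overline b+n)\alpha_{n-1}G_n(z).$$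
   Context: $\mathbb N=\{1,2,\dots\}$, $\mathbb T=\{|z|=1\}$ (counterclockwise), $d\mu(z)=\frac{\nu(z)}{\mathrm i z}dz$. Powers are principal branches, so $\nu(e^{\mathrm i\theta})=e^{-\eta(\theta-\pi)}(4\sin^2(\theta/2))^{\lambda}$ for $0<\theta<2\pi$. $\Phi_n$ is the monic polynomial of degree $n$ with $\int_{\mathbb T}\Phi_n\overline{\Phi_m}\,d\mu=\kappa_n^{-2}\delta_{n,m}$, $\kappa_n>0$; $\Phi_n^*(z)=z^n\overline{\Phi_n(1/\bar z)}$; $\alpha_{n-1}=-\overline{\Phi_n(0)}$ for $n\ge1$. For $z\notin\mathbb T$, $$G_n(z)=\frac1{2\pi \mathrm i}\int_{\mathbb T}\frac{\Phi_n(t)}{t-z}\frac{\nu(t)}{t^n}dt,\qquad G_{n-1}^*(z)=\frac1{2\pi \mathrm i}\int_{\mathbb T}\frac{\Phi_{n-1}^*(t)}{t-z}\frac{\nu(t)}{t^n}dt .$$ *)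

(* Defs.v *)
From HB Require Import structures.
From mathcomp Require Import all_boot all_order all_algebra.
From mathcomp Require Import complex.
From mathcomp Require Import all_classical all_reals all_analysis.

Set Implicit Arguments.
Unset Strict Implicit.
Unset Printing Implicit Defensive.

Import Order.TTheory GRing.Theory Num.Theory.
Import numFieldNormedType.Exports.

Local Open Scope classical_set_scope.
Local Open Scope ring_scope.

Section ComplexFunctions.
Context {R : realType}.
Local Notation C := R[i].
Implicit Types (z w : C) (t : R).

(* e^{it} *)
Definition expi t : C := (cos t +i* sin t)%C.

Definition cexp z : C := (expR (complex.Re z))%:C%C * expi (complex.Im z).

(* [`|z|%R] is complex-valued, hence the projection to R *)
Definition cabs z : R := complex.Re `|z|.

(* principal argument, with values in ]-pi, pi] for z != 0 *)
Definition carg z : R :=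
  let a := acos (complex.Re z / cabs z) in
  if 0 <= complex.Im z then a else - a.

(* principal logarithm (for z != 0) *)
Definition clog z : C := (ln (cabs z) +i* carg z)%C.

(* principal branch of z^w; the value at z = 0 follows the convention of powR *)
Definition cpow z w : C :=
  if z == 0 then (w == 0)%:R else cexp (w * clog z).

(* Lebesgue integral of a complex-valued function of a real variable *)
Definition cRintegral (D : set R) (f : R -> C) : C :=
  (Rintegral lebesgue_measure D (fun t => complex.Re (f t)) +i*
   Rintegral lebesgue_measure D (fun t => complex.Im (f t)))%C.

(* \int_T f(z) dz over the unit circle, parametrized counterclockwise by
   z = e^{it}, dz = i e^{it} dt *)
Definition circle_integral (f : C -> C) : C :=
  cRintegral `[0, 2 * pi] (fun t => f (expi t) * ('i * expi t)).

End ComplexFunctions.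

Section OrthogonalPolynomials.
Context {R : realType}.
Local Notation C := R[i].
Implicit Types (nu f : C -> C) (p : {poly C}) (Phi : nat -> {poly C}) (z : C).

(* \int_T f dmu, where dmu(z) = nu(z) / (i z) dz *)
Definition mu_integral nu f : C :=
  circle_integral (fun z => f z * (nu z / ('i * z))).

(* Phi n is the monic orthogonal polynomial of degree n, and kappa n is the
   leading coefficient of the orthonormal one *)
Definition monic_orthogonal nu Phi (kappa : nat -> R) : Prop :=
  [/\ forall n, Phi n \is monic,
      forall n, size (Phi n) = n.+1,
      forall n, 0 < kappa n &
      forall n m, mu_integral nu (fun z => (Phi n).[z] * ((Phi m).[z])^*)
                  = if n == m then (kappa n ^- 2)%:C%C else 0].

(* The polynomial z^n * conj(p(1 / conj z)); see reversed_polyE. It is given by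
   its coefficients since the formula itself makes no sense at z = 0. *)
Definition reversed_poly (n : nat) p : {poly C} :=
  \poly_(k < n.+1) (p`_(n - k))^*.

Lemma reversed_polyE n p z : (size p <= n.+1)%N -> z != 0 ->
  (reversed_poly n p).[z] = z ^+ n * (p.[1 / z^*])^*.
Proof.
move=> sp z0; rewrite horner_poly (horner_coef_wide _ sp) rmorph_sum mulr_sumr.
rewrite (reindex_inj rev_ord_inj) /=; apply: eq_bigr => i _.
have in_ : (i <= n)%N by rewrite -ltnS.
rewrite subSS subKn// rmorphM rmorphXn/= div1r fmorphV/= conjCK mulrCA.
by rewrite exprVn expfB_cond ?(negbTE z0).
Qed.

(* alpha_n = - conj(Phi_{n+1}(0)) *)
Definition verblunsky Phi (n : nat) : C := - ((Phi n.+1).[0])^*.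

(* 1/(2 pi i) \int_T p(t) / (t - z) * nu(t) / t^n dt *)
Definition cauchy_transform nu p (n : nat) z : C :=
  (2 * pi%:C%C * 'i)^-1 *
  circle_integral (fun t => p.[t] / (t - z) * (nu t / t ^+ n)).

Definition G_fun nu Phi (n : nat) : C -> C :=
  cauchy_transform nu (Phi n) n.

(* With index n - 1 the weight is nu(t) / t^n. *)
Definition Gstar_fun nu Phi (n : nat) : C -> C :=
  cauchy_transform nu (reversed_poly n (Phi n)) n.+1.

(* nu(z) = (-z)^{- conj b} (1 - z)^{b + conj b} *)
Definition circle_weight (b : C) z : C :=
  cpow (- z) (- b^*) * cpow (1 - z) (b + b^*).

End OrthogonalPolynomials.

(* Main.v *)
Require Import Defs.
From HB Require Import structures.
From mathcomp Require Import all_boot all_order all_algebra.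
From mathcomp Require Import complex ring lra zify.
From mathcomp Require Import all_classical all_reals all_analysis.
From mathcomp Require Import measurable_realfun.

Set Implicit Arguments.
Unset Strict Implicit.
Unset Printing Implicit Defensive.

Import Order.TTheory GRing.Theory Num.Theory.
Import numFieldNormedType.Exports.

Local Open Scope classical_set_scope.
Local Open Scope ring_scope.

(* On ]0, 2 pi[ the weight is w(t) = exp(-eta (t - pi)) (2 sin(t/2))^(2 lambda),
   and z (1 - z) nu' = - (conj b + b z) nu. Since (1 - z) nu vanishes at both ends
   of the arc (lambda > -1/2), integrating d/dt [(1 - z) F(z) w] gives, for every
   smooth F on the circle,
     int ((1 - z) z F' - (z + conj b + b z) F) w dt = 0.
   With F = p z^-k this yields the orthogonality relations that identify
   (1 - z) Phi_n' + n Phi_n and (1 - z) Phi*_(n-1)' - b Phi*_(n-1) as multiples of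
   Phi_(n-1); together with the Szego recurrence these are the two polynomial
   identities. With F = p t^(1-n) / (t - z) it expresses z (1 - z) G' through the
   Cauchy transform of t (1 - t) p', and the polynomial identities apply. *)

(** * Calculus of complex-valued functions of a real variable *)

Section ComplexCurves.
Context {R : realType}.
Local Notation C := R[i].
Local Notation Re := complex.Re.
Local Notation Im := complex.Im.
Implicit Types (f g : R -> C) (x y d e : C) (t : R).

(** The polynomial identities are proved as pure algebra. The pairing <p, z^k>, with k natural, is
    treated as an abstract Hermitian Toeplitz functional, and analysis enters only through its
    Pearson relation. Laurent polynomials never appear: where a negative power of z would occur,
    both sides are shifted by a factor ['X]. Two analytic obstacles shape the rest. For lambda < 0
    the weight blows up at t = 0 and t = 2 pi, so the integration by parts needs a fundamental
    theorem that asks for continuity of the primitive on the closed interval but only integrability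
    of its derivative. And integrability of the weight is read off the orthogonality hypothesis: a
    divergent mass would be assigned the value 0, whereas it equals kappa_0^-2. For the two Cauchy
    transforms the reduction also leaves terms free of z, multiples of <Phi_n, z^(n-1)> and of (n-1)
    <Phis, z^(n-1)>, where Phis is the reversed polynomial of Phi_(n-1). The first vanishes by
    orthogonality; the second does so for n > 1, and for n = 1 because of its factor. *)

Lemma ReM x y : Re (x * y) = Re x * Re y - Im x * Im y.
Proof. by case: x; case: y. Qed.

Lemma ImM x y : Im (x * y) = Re x * Im y + Im x * Re y.
Proof. by case: x => a b; case: y. Qed.

Lemma ReD x y : Re (x + y) = Re x + Re y.
Proof. by case: x; case: y. Qed.

Lemma ImD x y : Im (x + y) = Im x + Im y.
Proof. by case: x; case: y. Qed.

Lemma ReV x : Re x^-1 = Re x / (Re x ^+ 2 + Im x ^+ 2).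
Proof. by case: x. Qed.

Lemma ImV x : Im x^-1 = - (Im x / (Re x ^+ 2 + Im x ^+ 2)).
Proof. by case: x. Qed.

Lemma complex_eqP x y : Re x = Re y -> Im x = Im y -> x = y.
Proof. by case: x => a b; case: y => c d /= -> ->. Qed.

Lemma normsq_neq0 x : x != 0 -> Re x ^+ 2 + Im x ^+ 2 != 0.
Proof.
apply: contraNneq => /eqP; rewrite paddr_eq0 ?sqr_ge0// !sqrf_eq0.
by move=> /andP[/eqP a /eqP b]; apply/eqP/complex_eqP.
Qed.

(** Working by components lets the real one-variable theorems (chain rule, mean value, fundamental
    theorem) apply directly. *)
Definition is_cderive f t d :=
  is_derive t 1 (fun s => Re (f s)) (Re d) /\
  is_derive t 1 (fun s => Im (f s)) (Im d).

Definition ccontinuous f :=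
  continuous (fun s => Re (f s)) /\ continuous (fun s => Im (f s)).

Lemma is_cderive_eq f t d e : is_cderive f t d -> d = e -> is_cderive f t e.
Proof. by move=> + <-. Qed.

Lemma is_cderive_cst x t : is_cderive (fun=> x) t 0.
Proof. by split; exact: is_derive_cst. Qed.

Lemma is_cderiveD f g t d e : is_cderive f t d -> is_cderive g t e ->
  is_cderive (fun s => f s + g s) t (d + e).
Proof.
move=> [fr fi] [gr gi]; split.
- rewrite (_ : (fun s => _) = (fun s => Re (f s)) + (fun s => Re (g s))).
    by rewrite ReD; exact: is_deriveD.
  by apply/funext => s; rewrite ReD.
- rewrite (_ : (fun s => _) = (fun s => Im (f s)) + (fun s => Im (g s))).
    by rewrite ImD; exact: is_deriveD.
  by apply/funext => s; rewrite ImD.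
Qed.

Lemma is_cderiveM f g t d e : is_cderive f t d -> is_cderive g t e ->
  is_cderive (fun s => f s * g s) t (d * g t + f t * e).
Proof.
move=> [fr fi] [gr gi]; split.
- under eq_fun do rewrite ReM.
  apply: is_derive_eq; rewrite /GRing.scale/= !ReD !ReM; ring.
- under eq_fun do rewrite ImM.
  apply: is_derive_eq; rewrite /GRing.scale/= !ImD !ImM; ring.
Qed.

Lemma is_cderiveV f t d : f t != 0 -> is_cderive f t d ->
  is_cderive (fun s => (f s)^-1) t (- d / f t ^+ 2).
Proof.
move=> /normsq_neq0 f0 [fr fi].
pose a s := Re (f s); pose b s := Im (f s).
have n0 : (a ^+ 2 + b ^+ 2) t != 0 by [].
have dn : is_derive t 1 (a ^+ 2 + b ^+ 2) (2 * a t * Re d + 2 * b t * Im d).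
  by apply: is_derive_eq; rewrite /GRing.scale/= !expr1 !mulr_natl.
have dnV := is_deriveV n0 dn.
apply: (@is_cderive_eq _ _ (- (d / f t / f t))); last first.
  by rewrite expr2 invfM mulNr mulrA.
split.
- under eq_fun do rewrite ReV.
  apply: (is_derive_eq (is_deriveM fr dnV)).
  rewrite /GRing.scale/= /a /b in n0 *; rewrite !fctE/= in n0 *.
  case: (f t) (d) n0 => u v [u' v'] /= n0; field.
  by rewrite n0.
- under eq_fun do rewrite ImV.
  apply: (is_derive_eq (is_deriveN (is_deriveM fi dnV))).
  rewrite /GRing.scale/= /a /b in n0 *; rewrite !fctE/= in n0 *.
  case: (f t) (d) n0 => u v [u' v'] /= n0; field.
  by rewrite n0.
Qed.

Lemma ccontinuous_cst x : ccontinuous (fun=> x).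
Proof. by split => t; exact: cvg_cst. Qed.

Lemma ccontinuousD f g : ccontinuous f -> ccontinuous g ->
  ccontinuous (fun s => f s + g s).
Proof.
move=> [fr fi] [gr gi]; split=> t.
- by under eq_fun do rewrite ReD; apply: cvgD; [exact: fr|exact: gr].
- by under eq_fun do rewrite ImD; apply: cvgD; [exact: fi|exact: gi].
Qed.

Lemma ccontinuousM f g : ccontinuous f -> ccontinuous g ->
  ccontinuous (fun s => f s * g s).
Proof.
move=> [fr fi] [gr gi]; split=> t.
- under eq_fun do rewrite ReM.
  by apply: cvgB; apply: cvgM; (exact: fr||exact: gr||exact: fi||exact: gi).
- under eq_fun do rewrite ImM.
  by apply: cvgD; apply: cvgM; (exact: fr||exact: gr||exact: fi||exact: gi).
Qed.

Lemma ccontinuousN f : ccontinuous f -> ccontinuous (fun s => - f s).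
Proof.
move=> /(ccontinuousM (ccontinuous_cst (-1))).
by under [X in ccontinuous X]eq_fun do rewrite mulN1r.
Qed.

Lemma ccontinuousB f g : ccontinuous f -> ccontinuous g ->
  ccontinuous (fun s => f s - g s).
Proof. by move=> cf cg; apply: ccontinuousD => //; exact: ccontinuousN. Qed.

Lemma ccontinuousV f : (forall t, f t != 0) -> ccontinuous f ->
  ccontinuous (fun s => (f s)^-1).
Proof.
move=> f0 [fr fi].
have dn t : (Re (f s) ^+ 2 + Im (f s) ^+ 2)^-1 @[s --> t] -->
    (Re (f t) ^+ 2 + Im (f t) ^+ 2)^-1.
  apply: cvgV; first exact/normsq_neq0.
  by apply: cvgD; rewrite expr2; under eq_fun do rewrite expr2;
    apply: cvgM; (exact: fr||exact: fi).
split=> t.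
- by under eq_fun do rewrite ReV; apply: cvgM; [exact: fr|exact: dn].
- by under eq_fun do rewrite ImV; apply: cvgN; apply: cvgM; [exact: fi|exact: dn].
Qed.

Lemma is_cderive_continuous f (f' : R -> C) :
  (forall t, is_cderive f t (f' t)) -> ccontinuous f.
Proof.
move=> df; split=> t; have [d1 d2] := df t;
  apply: differentiable_continuous; apply/derivable1_diffP.
- exact: (@ex_derive _ _ _ _ _ _ _ d1).
- exact: (@ex_derive _ _ _ _ _ _ _ d2).
Qed.

Lemma is_cderive_expi t : is_cderive expi t ('i * expi t).
Proof.
split; apply: is_derive_eq; rewrite ?ReM ?ImM /=; ring.
Qed.

Lemma is_cderive_real (h : R -> R) t (d' : R) : is_derive t 1 h d' ->
  is_cderive (fun s => (h s)%:C%C) t d'%:C%C.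
Proof. by move=> dh; split => //=; exact: is_derive_cst. Qed.

End ComplexCurves.

(** * A fundamental theorem with integrable derivative, and the weight in the angle variable *)

Section JacobiWeight.
Context {R : realType}.
Local Notation C := R[i].
Local Notation Re := complex.Re.
Local Notation Im := complex.Im.
Local Notation mu := (@lebesgue_measure R).
Implicit Types (t : R).

(** [dh] may be unbounded near the endpoints. Integrability alone makes its primitive [G] continuous
    on the closed interval; [G - h] has zero derivative inside, and the mean value theorem equates
    its values at [a] and [b]. *)
Lemma integrable_FTC2 (h dh : R -> R) a b : a < b ->
  {within `[a, b], continuous h} ->
  (forall x, x \in `]a, b[ -> is_derive x 1 h (dh x)) ->
  {in `]a, b[, continuous dh} ->
  mu.-integrable `[a, b] (EFin \o dh) ->
  \int[mu]_(x in `[a, b]) dh x = h b - h a.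
Proof.
move=> ab ch dhE cdh idh.
pose G x := \int[mu]_(t in `[a, x]) dh t.
have dG x : x \in `]a, b[ -> is_derive x 1 G (dh x).
  move=> xab; have /andP[ax xb] : a < x < b by rewrite in_itv in xab.
  have [d1 d2] := continuous_FTC1_closed xb idh ax (cdh _ xab).
  by split; [exact: d1|rewrite -derive1E d2].
have dGh x : x \in `]a, b[ -> is_derive x 1 (G - h) (cst 0 x).
  by move=> xab; rewrite /= -(subrr (dh x)); apply: is_deriveB; [exact: dG|exact: dhE].
have cGh : {within `[a, b], continuous (G - h)}.
  move=> x; apply: cvgB; last exact: ch.
  exact: (parameterized_integral_continuous (ltW ab) idh).
have [c _ ] := MVT_segment (ltW ab) dGh cGh.
rewrite mul0r !fctE {2}/G set_itv1 Rintegral_set1 sub0r opprK.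
by rewrite -/(G b) => E; lra.
Qed.

(** The distance |1 - e^{it}| for t in [0, 2 pi], without the absolute value so that it is smooth on
    the whole line. *)
Definition chord t : R := 2 * sin (t / 2).

Definition jacobi_weight (lam eta : R) t : R :=
  expR (- eta * (t - pi)) * (chord t ^+ 2) `^ lam.

Lemma chord_gt0 t : t \in `]0, 2 * pi[ -> 0 < chord t.
Proof.
rewrite in_itv/= => /andP[t0 t2]; rewrite mulr_gt0// sin_gt0_pi//.
by rewrite divr_gt0//= ltr_pdivrMr// mulrC.
Qed.

Lemma jacobi_weight_ge0 lam eta t : 0 <= jacobi_weight lam eta t.
Proof. by rewrite mulr_ge0 ?expR_ge0 ?powR_ge0. Qed.

Lemma expiD (s t : R) : expi (s + t) = expi s * expi t.
Proof.
apply: complex_eqP; rewrite ?ReM ?ImM /= ?cosD ?sinD//.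
by rewrite addrC [X in X + _]mulrC.
Qed.

Lemma expi_half t : expi t = expi (t / 2) ^+ 2.
Proof. by rewrite expr2 -expiD -splitr. Qed.

Lemma norm_expi t : `|expi t| = 1.
Proof. by rewrite normc_def /= cos2Dsin2 sqrtr1. Qed.

Lemma expi_neq0 t : expi t != 0.
Proof. by rewrite -normr_eq0 norm_expi oner_neq0. Qed.

Lemma onem_expi t :
  1 - expi t = - 'i * expi (t / 2) * (chord t)%:C%C.
Proof.
rewrite expi_half /chord expr2; apply: complex_eqP; rewrite ?(ReM,ImM,ReD,ImD)/=;
 have := cos2Dsin2 (t / 2); set c := cos _; set s := sin _ => h; nra.
Qed.

(** Away from 0 the power is differentiable; at 0 positivity of [q] forces the limit 0. It is
    applied with q = lam + 1/2, which is where the bound on lambda enters. *)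
Lemma continuous_sqr_powR (q : R) : 0 < q ->
  continuous (fun x : R => (x ^+ 2) `^ q).
Proof.
move=> q0 x; have [->|x0] := eqVneq x 0.
  rewrite /continuous_at expr0n/= powR0 ?gt_eqF//.
  apply/cvgrPdist_lt => e e0; near=> y.
  rewrite sub0r normrN ger0_norm ?powR_ge0//.
  have -> : e = (e `^ (q^-1)) `^ q by rewrite -powRrM mulVf ?gt_eqF// powRr1 ?ltW.
  apply: gt0_ltr_powR => //; rewrite ?nnegrE ?sqr_ge0 ?powR_ge0//.
  near: y.
  have : (fun y : R => y ^+ 2) @ (0:R) --> ((0:R) ^+ 2).
    by rewrite expr2; under eq_fun do rewrite expr2; apply: cvgM.
  rewrite expr0n/= => /cvgr_lt; apply; exact: powR_gt0.
have sq : (fun y : R => y ^+ 2) @ x --> x ^+ 2.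
  by rewrite expr2; under eq_fun do rewrite expr2; apply: cvgM.
have pw : {for x ^+ 2, continuous (fun y : R => y `^ q)}.
  apply: differentiable_continuous; apply/derivable1_diffP.
  by apply: ex_derive; apply: is_derive1_powR; rewrite exprn_even_gt0.
exact: (cvg_comp _ _ sq pw).
Unshelve. all: by end_near. Qed.

Lemma is_derive_chord t : is_derive t 1 chord (cos (t / 2)).
Proof.
have h : is_derive t 1 (fun s : R => s / 2) 2^-1.
  by apply: is_derive_eq; rewrite /GRing.scale/=; field.
have h2 : is_derive t 1 (sin \o (fun s : R => s / 2)) (cos (t / 2) * 2^-1).
  exact: is_derive1_comp.
rewrite (_ : chord = (2:R) *: (sin \o (fun s : R => s / 2))); last exact/funext.
by apply: is_derive_eq; rewrite /GRing.scale/=; field.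
Qed.

End JacobiWeight.

(** * Principal branches, and the regularised product (1 - z) nu *)

Section CircleWeight.
Context {R : realType}.
Local Notation C := R[i].
Local Notation Re := complex.Re.
Local Notation Im := complex.Im.
Local Notation mu := (@lebesgue_measure R).
Implicit Types (t lam eta : R).

Lemma clog_polar (r p : R) : 0 < r -> - pi < p < pi ->
  clog (r%:C%C * expi p) = (ln r +i* p)%C.
Proof.
move=> r0 /andP[p1 p2]; rewrite /clog.
have -> : cabs (r%:C%C * expi p) = r.
  by rewrite /cabs normrM norm_expi mulr1 normc_def /= expr0n addr0 sqrtr_sqr gtr0_norm.
congr (_ +i* _)%C; rewrite /carg /cabs normrM norm_expi mulr1 normc_def /=.
rewrite expr0n addr0 sqrtr_sqr gtr0_norm// !mul0r subr0 addr0.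
rewrite [r * cos p]mulrC mulfK ?gt_eqF//.
have [p0|p0] := leP 0 p.
  rewrite cosK; last by rewrite in_itv/= p0 ltW.
  rewrite ifT// mulr_ge0 ?(ltW r0)//.
  by apply: sin_ge0_pi; rewrite p0 ltW.
rewrite cosKN ?(ltW p0) ?(ltW p1)// opprK ifF//.
by apply/negbTE; rewrite -ltNge pmulr_rlt0// -oppr_gt0 -sinN sin_gt0_pi// oppr_gt0 p0/=; lra.
Qed.

Lemma cexpD (x y : C) : cexp (x + y) = cexp x * cexp y.
Proof. by rewrite /cexp ReD ImD expiD expRD rmorphM/= mulrACA. Qed.

Lemma jacobi_weightE lam eta t : t \in `]0, 2 * pi[ ->
  jacobi_weight lam eta t =
  expR (- eta * (t - pi) + 2 * lam * ln (chord t)).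
Proof.
move=> /chord_gt0 u0; rewrite /jacobi_weight expRD; congr (_ * _).
rewrite /powR expf_eq0/= gt_eqF//; congr expR.
by rewrite lnXn// -mulr_natr; ring.
Qed.

(** On the open arc -e^{it} has argument t - pi, and 1 - e^{it} has modulus [chord t] and argument
    (t - pi)/2, both strictly between -pi and pi. In the sum of the two exponents the imaginary
    parts -lam (t - pi) and 2 lam (t - pi)/2 cancel, so the weight is real. *)
Lemma circle_weight_expi lam eta t : t \in `]0, 2 * pi[ ->
  circle_weight (lam +i* eta)%C (expi t) = (jacobi_weight lam eta t)%:C%C.
Proof.
move=> tI; have u0 := chord_gt0 tI; have := tI; rewrite in_itv/= => /andP[t0 t2].
have e1 : - expi t = 1%:C%C * expi (t - pi).
  apply: complex_eqP => /=.
    by rewrite !(mul1r,mul0r,subr0) -[t in LHS](subrK pi) cosDpi opprK.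
  by rewrite !(mul1r,mul0r,addr0) -[t in LHS](subrK pi) sinDpi opprK.
have e2 : 1 - expi t = (chord t)%:C%C * expi ((t - pi) / 2).
  rewrite onem_expi mulrC; congr (_ * _).
  have -> : (t - pi) / 2 = t / 2 - pi / 2 by field.
  by apply: complex_eqP; rewrite /= ?cosBpihalf ?sinBpihalf ?ReM ?ImM/=; ring.
have n1 : - expi t != 0 by rewrite oppr_eq0 expi_neq0.
have n2 : 1 - expi t != 0.
  by rewrite e2 mulf_neq0 ?expi_neq0//; apply/eqP => -[] /eqP; rewrite gt_eqF.
rewrite /circle_weight /cpow (negbTE n1) (negbTE n2) -cexpD e2 e1.
have i1 : - pi < t - pi < pi by apply/andP; split; lra.
have i2 : - pi < (t - pi) / 2 < pi by apply/andP; split; lra.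
rewrite (clog_polar ltr01 i1) (clog_polar u0 i2).
rewrite ln1 jacobi_weightE//.
set L := ln _.
have -> : - (lam +i* eta)%C^* * (0 +i* (t - pi))%C +
   ((lam +i* eta)%C + (lam +i* eta)%C^*) * (L +i* ((t - pi) / 2))%C
   = (- eta * (t - pi) + 2 * lam * L)%:C%C.
  by apply: complex_eqP; rewrite !(ReM,ImM,ReD,ImD) /=; field.
rewrite /cexp /= -[RHS]mulr1; congr (_ * _).
by apply: complex_eqP; rewrite /= ?cos0 ?sin0.
Qed.

(* (1 - e^{it}) w(t), rewritten with the exponent lam + 1/2 > 0 so that it is
   continuous on the whole line and vanishes at 0 and 2 pi. *)
Definition weight_primitive lam eta t : C :=
  - 'i * expi (t / 2) * (expR (- eta * (t - pi)) * (chord t ^+ 2) `^ (lam + 2^-1))%:C%C.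

Lemma powR_half (u : R) lam : 0 < u -> (u ^+ 2) `^ (lam + 2^-1) = (u ^+ 2) `^ lam * u.
Proof.
move=> u0; rewrite powRD; last first.
  by apply/implyP => _; rewrite expf_neq0// gt_eqF.
by rewrite powR12_sqrt ?sqr_ge0// sqrtr_sqr gtr0_norm.
Qed.

Lemma weight_primitiveE lam eta t : t \in `]0, 2 * pi[ ->
  weight_primitive lam eta t = (1 - expi t) * (jacobi_weight lam eta t)%:C%C.
Proof.
move=> tI; rewrite /weight_primitive powR_half ?chord_gt0// onem_expi /jacobi_weight.
by rewrite !rmorphM/=; ring.
Qed.

Lemma weight_primitive_bnd lam eta : - (1 / 2) < lam ->
  weight_primitive lam eta 0 = 0 /\ weight_primitive lam eta (2 * pi) = 0.
Proof.
move=> l; have l0 : lam + 2^-1 != 0 by rewrite gt_eqF//; lra.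
rewrite /weight_primitive /chord mul0r sin0 mulr0.
rewrite (_ : 2 * pi / 2 = pi :> R); last by field.
by rewrite sinpi mulr0 expr0n/= powR0// !mulr0.
Qed.

Lemma is_derive_expR_affine eta t :
  is_derive t 1 (fun s : R => expR (- eta * (s - pi)))
    (- eta * expR (- eta * (t - pi))).
Proof.
have h : is_derive t 1 (fun s : R => - eta * (s - pi)) (- eta).
  by apply: is_derive_eq; rewrite /GRing.scale/=; ring.
apply: (is_derive_eq (is_derive1_comp (is_derive_expR _) h)).
by rewrite /GRing.scale/= mulrC.
Qed.

Lemma is_cderive_expi_half t :
  is_cderive (fun s : R => expi (s / 2)) t ((0 +i* 2^-1)%C * expi (t / 2)).
Proof.
have h : is_derive t 1 (fun s : R => s / 2) 2^-1.
  by apply: is_derive_eq; rewrite /GRing.scale/=; field.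
split.
  apply: (is_derive_eq (is_derive1_comp (is_derive_cos _) h)).
  by rewrite !(ReM, ImM)/=; ring.
apply: (is_derive_eq (is_derive1_comp (is_derive_sin _) h)).
by rewrite !(ReM, ImM)/=; ring.
Qed.

Lemma ccontinuous_weight_primitive lam eta : - (1 / 2) < lam ->
  ccontinuous (weight_primitive lam eta).
Proof.
move=> l.
have ce : ccontinuous (fun t : R => expi (t / 2)).
  by apply: is_cderive_continuous => t; exact: is_cderive_expi_half.
apply: ccontinuousM; first by apply: ccontinuousM => //; exact: ccontinuous_cst.
split=> t /=; last exact: cvg_cst.
apply: cvgM.
  have := @ex_derive _ _ _ _ _ _ _ (is_derive_expR_affine eta t).
  by move/derivable1_diffP/differentiable_continuous.
have := @ex_derive _ _ _ _ _ _ _ (is_derive_chord t).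
move/derivable1_diffP/differentiable_continuous => ch.
have l0 : 0 < lam + 2^-1 by lra.
have cp := continuous_sqr_powR l0 (x := chord t).
by have := cvg_comp _ _ ch cp.
Qed.


(** This is the Pearson equation z (1 - z) nu' = - (conj b + b z) nu in the angle; the extra
    [- expi t] comes from differentiating 1 - z. *)
Lemma is_cderive_weight_primitive lam eta t : t \in `]0, 2 * pi[ ->
  let b := (lam +i* eta)%C in
  is_cderive (weight_primitive lam eta) t
    ('i * (- expi t - b^* - b * expi t) * (jacobi_weight lam eta t)%:C%C).
Proof.
move=> tI b; have u0 := chord_gt0 tI.
set u := chord t in u0.
have dv : is_derive t 1 (fun s => (chord s ^+ 2) `^ (lam + 2^-1))
    ((2 * lam + 1) * (u ^+ 2) `^ lam * cos (t / 2)).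
  have d2 : is_derive t 1 (fun s => chord s ^+ 2) (2 * u * cos (t / 2)).
    have dc := is_derive_chord t.
    under eq_fun do rewrite expr2.
    by apply: is_derive_eq; rewrite /GRing.scale/= -/u; ring.
  have dp : is_derive (u ^+ 2) 1 (fun y : R => y `^ (lam + 2^-1))
      ((lam + 2^-1) * (u ^+ 2) `^ (lam + 2^-1 - 1)).
    by apply: is_derive1_powR; rewrite exprn_even_gt0//= gt_eqF.
  have dd : is_derive t 1 ((fun y : R => y `^ (lam + 2^-1)) \o (fun s => chord s ^+ 2))
      ((lam + 2^-1) * (u ^+ 2) `^ (lam + 2^-1 - 1) * (2 * u * cos (t / 2))).
    exact: is_derive1_comp.
  apply: (is_derive_eq dd).
  (* The chain rule leaves the exponent lam - 1/2; the factor [u] from the derivative of the square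
     raises it to lam. *)
  have -> : (u ^+ 2) `^ lam = (u ^+ 2) `^ (lam + 2^-1 - 1) * u.
    by rewrite -powR_half//; congr powR; field.
  by field.
have de := is_derive_expR_affine eta t.
have dr := is_cderive_real (is_deriveM de dv).
have dE := is_cderiveM (is_cderive_cst (- 'i) t) (is_cderive_expi_half t).
apply: (is_cderive_eq (is_cderiveM dE dr)).
rewrite /jacobi_weight /GRing.scale/= -/u powR_half// (expi_half t).
set X := expR _; set P := _ `^ lam; rewrite /u /chord.
set q := t / 2.
(* Multiplying by cos^2 + sin^2 = 1 makes every term quadratic in cos q and sin q, so the identity
   holds formally and [field] needs no trigonometric relation. *)
have -> : b^* = b^* * (cos q ^+ 2 + sin q ^+ 2)%:C%C by rewrite cos2Dsin2 mulr1.
rewrite !fctE powR_half// -/X -/P /u /chord -/q.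
by apply: complex_eqP; 
  rewrite !(expr2, ReM, ImM, ReD, ImD)/= ?(expr2, ReM, ImM, ReD, ImD)/=; field.
Qed.


End CircleWeight.

(** * Integration against the weight, and Pearson's identity *)

Section CircleFunctional.
Context {R : realType}.
Local Notation C := R[i].
Local Notation Re := complex.Re.
Local Notation Im := complex.Im.
Local Notation mu := (@lebesgue_measure R).
Implicit Types (t lam eta : R) (F : C -> C).

Lemma jacobi_weight_continuous lam eta t : t \in `]0, 2 * pi[ ->
  {for t, continuous (jacobi_weight lam eta)}.
Proof.
move=> /chord_gt0 u0.
have d2 : is_derive t 1 (fun s => chord s ^+ 2) (2 * chord t * cos (t / 2)).
  have dc := is_derive_chord t.
  under eq_fun do rewrite expr2.
  by apply: is_derive_eq; rewrite /GRing.scale/=; ring.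
have dp : is_derive (chord t ^+ 2) 1 (fun y : R => y `^ lam)
    (lam * (chord t ^+ 2) `^ (lam - 1)).
  by apply: is_derive1_powR; rewrite exprn_even_gt0//= gt_eqF.
have dd : is_derive t 1 ((fun y : R => y `^ lam) \o (fun s => chord s ^+ 2))
    (lam * (chord t ^+ 2) `^ (lam - 1) * (2 * chord t * cos (t / 2))).
  exact: is_derive1_comp.
have := @ex_derive _ _ _ _ _ _ _ (is_deriveM (is_derive_expR_affine eta t) dd).
by move/derivable1_diffP/differentiable_continuous.
Qed.

Lemma measurable_jacobi_weight lam eta (D : set R) :
  measurable_fun D (jacobi_weight lam eta).
Proof.
apply: (@measurable_funS _ _ _ _ setT) => //.
have ce : continuous (fun s : R => expR (- eta * (s - pi))).
  move=> t; have := @ex_derive _ _ _ _ _ _ _ (is_derive_expR_affine eta t).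
  by move/derivable1_diffP/differentiable_continuous.
have cc : continuous (@chord R).
  move=> t; have := @ex_derive _ _ _ _ _ _ _ (is_derive_chord t).
  by move/derivable1_diffP/differentiable_continuous.
apply: measurable_funM; first exact: continuous_measurable_fun.
apply: (measurableT_comp (measurable_powR lam)).
apply: measurable_funX; exact: continuous_measurable_fun.
Qed.

Definition circ_continuous F := ccontinuous (fun t => F (expi t)).

(** The factor ['i * expi t] is dz/dt, so [F'] is the derivative with respect to z taken along the
    circle. *)
Definition circ_derive F (F' : C -> C) :=
  forall t, is_cderive (fun s => F (expi s)) t ('i * expi t * F' (expi t)).

Definition weighted_integral lam eta F : C :=
  cRintegral `[0, 2 * pi] (fun t => F (expi t) * (jacobi_weight lam eta t)%:C%C).

Lemma Re_weighted lam eta F : Re (weighted_integral lam eta F) =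
  \int[mu]_(t in `[0, 2 * pi]) (Re (F (expi t)) * jacobi_weight lam eta t).
Proof. by apply: eq_Rintegral => t _; rewrite ReM /= mulr0 subr0. Qed.

Lemma Im_weighted lam eta F : Im (weighted_integral lam eta F) =
  \int[mu]_(t in `[0, 2 * pi]) (Im (F (expi t)) * jacobi_weight lam eta t).
Proof. by apply: eq_Rintegral => t _; rewrite ImM /= mulr0 add0r. Qed.

(** Carried as a hypothesis until the normalisation of the orthogonal polynomials supplies it. *)
Definition weight_integrable lam eta :=
  mu.-integrable `[0, 2 * pi] (EFin \o jacobi_weight lam eta).

Lemma integrable_weighted lam eta (g : R -> R) : weight_integrable lam eta ->
  continuous g ->
  mu.-integrable `[0, 2 * pi] (EFin \o (fun t => g t * jacobi_weight lam eta t)).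
Proof.
move=> iw cg.
have mg : measurable_fun `[0, 2 * pi] g.
  by apply: (@measurable_funS _ _ _ _ setT) => //; exact: continuous_measurable_fun.
have bg : [bounded g t | t in `[0, 2 * pi]].
  have /compact_bounded : compact (g @` `[0, 2 * pi]).
    apply: continuous_compact; last exact: segment_compact.
    exact: continuous_subspaceT.
  move=> [M [Mr bM]]; exists M; split => // N MN t tI.
  by apply: (bM N MN); exists t.
have mI : measurable (`[0, 2 * pi] : set (measurableTypeR R)) by [].
have := integrableMr mI mg bg iw; exact.
Qed.

Variables (lam eta : R).
Hypothesis wI : weight_integrable lam eta.
Local Notation J := (weighted_integral lam eta).

Lemma eq_weighted F G : (forall z, `|z| = 1 -> F z = G z) -> J F = J G.
Proof.
by move=> FG; apply: complex_eqP; rewrite ?Re_weighted ?Im_weighted;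
  apply: eq_Rintegral => t _; rewrite FG// norm_expi.
Qed.

Lemma weightedD F G : circ_continuous F -> circ_continuous G ->
  J (fun z => F z + G z) = J F + J G.
Proof.
move=> [fr fi] [gr gi]; apply: complex_eqP; rewrite ?ReD ?ImD ?Re_weighted ?Im_weighted.
- rewrite -RintegralD//; [|exact: (integrable_weighted wI fr)|exact: (integrable_weighted wI gr)].
  by apply: eq_Rintegral => t _; rewrite ReD mulrDl.
- rewrite -RintegralD//; [|exact: (integrable_weighted wI fi)|exact: (integrable_weighted wI gi)].
  by apply: eq_Rintegral => t _; rewrite ImD mulrDl.
Qed.

Lemma weightedZ a F : circ_continuous F -> J (fun z => a * F z) = a * J F.
Proof.
move=> [fr fi]; apply: complex_eqP; rewrite ?ReM ?ImM ?Re_weighted ?Im_weighted.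
- rewrite -!RintegralZl//; [|exact: integrable_weighted..].
  rewrite -RintegralB//; last 2 first.
  + exact: (integrableZl _ (Re a) (integrable_weighted wI fr)).
  + exact: (integrableZl _ (Im a) (integrable_weighted wI fi)).
  by apply: eq_Rintegral => t _; rewrite ReM; ring.
- rewrite -!RintegralZl//; [|exact: integrable_weighted..].
  rewrite -RintegralD//; last 2 first.
  + exact: (integrableZl _ (Re a) (integrable_weighted wI fi)).
  + exact: (integrableZl _ (Im a) (integrable_weighted wI fr)).
  by apply: eq_Rintegral => t _; rewrite ImM; ring.
Qed.

Lemma weighted_conj F : circ_continuous F -> J (fun z => (F z)^*) = (J F)^*.
Proof.
move=> [fr fi]; apply: complex_eqP.
- rewrite (_ : Re (J F)^* = Re (J F)); last by case: (J F).
  by rewrite !Re_weighted; apply: eq_Rintegral => t _; case: (F _).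
- rewrite (_ : Im (J F)^* = - 1 * Im (J F)); last by rewrite mulN1r; case: (J F).
  rewrite !Im_weighted -RintegralZl//; last exact: (integrable_weighted wI).
  by apply: eq_Rintegral => t _; case: (F _) => x y /=; ring.
Qed.

Definition weight_mass : R := \int[mu]_(t in `[0, 2 * pi]) jacobi_weight lam eta t.

Lemma norm_Rintegral_weighted (g : R -> R) (M : R) : continuous g ->
  (forall t, `|g t| <= M) ->
  `|\int[mu]_(t in `[0, 2 * pi]) (g t * jacobi_weight lam eta t)| <= M * weight_mass.
Proof.
move=> cg gM; have ig := integrable_weighted wI cg.
apply: (le_trans (le_normr_Rintegral _ ig)) => //.
rewrite -RintegralZl//; apply: le_Rintegral => //.
- by apply: (@integrable_norm _ _ _ mu `[0, 2 * pi] _ ig).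
- exact: (integrableZl _ M wI).
- by move=> t _; rewrite normrM ler_pM// ger0_norm// jacobi_weight_ge0.
Qed.

Lemma norm_le_ReIm (z : C) : `|z| <= (`|Re z| + `|Im z|)%:C%C.
Proof.
have {1}-> : z = (Re z)%:C%C + 'i * (Im z)%:C%C.
  by apply: complex_eqP; rewrite ?(ReD,ReM,ImD,ImM)/=; ring.
rewrite rmorphD (le_trans (ler_normD _ _))// normrM normCi mul1r.
by rewrite !normc_def /= !expr0n/= !addr0 !sqrtr_sqr.
Qed.

Lemma norm_Re_le (z : C) (M : R) : `|z| <= M%:C%C -> `|Re z| <= M.
Proof. by move=> zM; rewrite -lecR (le_trans (normc_ge_Re z)). Qed.

Lemma norm_Im_le (z : C) (M : R) : `|z| <= M%:C%C -> `|Im z| <= M.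
Proof.
move=> zM; have -> : `|Im z| = `|Re ('i * z)|.
  by rewrite ReM /= mul0r sub0r mul1r normrN.
by apply: norm_Re_le; rewrite normrM normCi mul1r.
Qed.

(** The factor 2 is the price of estimating real and imaginary parts separately; it is harmless in
    the error bound for difference quotients. *)
Lemma norm_weighted F (M : R) : circ_continuous F ->
  (forall z, `|z| = 1 -> `|F z| <= M%:C%C) -> `|J F| <= (2 * weight_mass * M)%:C%C.
Proof.
move=> [fr fi] FM; apply: (le_trans (norm_le_ReIm _)); rewrite lecR.
rewrite (_ : 2 * _ * _ = M * weight_mass + M * weight_mass); last by ring.
rewrite Re_weighted Im_weighted lerD// norm_Rintegral_weighted// => t.
- by apply: norm_Re_le; rewrite FM// norm_expi.
- by apply: norm_Im_le; rewrite FM// norm_expi.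
Qed.

Hypothesis lam_gt : - (1 / 2) < lam.

Lemma weighted_pearson F (F' : C -> C) : let b := (lam +i* eta)%C in
  circ_derive F F' -> circ_continuous F' ->
  J (fun z => (1 - z) * z * F' z - (z + b^* + b * z) * F z) = 0.
Proof.
move=> b dF cF'.
set G := fun z => _.
have cF : circ_continuous F by exact: is_cderive_continuous dF.
have cE : circ_continuous id by exact: is_cderive_continuous (@is_cderive_expi R).
have cG : circ_continuous G.
  have cst a : circ_continuous (fun=> a) by exact: ccontinuous_cst.
  rewrite /G; apply: ccontinuousB.
    apply: ccontinuousM => //; apply: ccontinuousM => //.
    by apply: ccontinuousB => //; exact: (cst 1).
  apply: ccontinuousM => //.
  by apply: ccontinuousD; [apply: ccontinuousD|apply: ccontinuousM] => //;
    [exact: (cst b^*)|exact: (cst b)].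
pose h t := weight_primitive lam eta t * F (expi t).
have ch : ccontinuous h.
  by apply: ccontinuousM => //; exact: ccontinuous_weight_primitive.
have [h0 h1] : h 0 = 0 /\ h (2 * pi) = 0.
  by have [w0 w1] := weight_primitive_bnd eta lam_gt; rewrite /h w0 w1 !mul0r.
have dh t : t \in `]0, 2 * pi[ ->
    is_cderive h t ('i * (G (expi t) * (jacobi_weight lam eta t)%:C%C)).
  move=> tI.
  apply: (is_cderive_eq (is_cderiveM (is_cderive_weight_primitive lam eta tI) (dF t))).
  by rewrite weight_primitiveE// /G -/b; ring.
have pi2 : 0 < 2 * pi :> R by rewrite mulr_gt0// pi_gt0.
have [Gr Gi] := cG; have [hr hi] := ch.
apply: complex_eqP; rewrite ?Re_weighted ?Im_weighted.
(* Since h' = i G w, the real part of G w is the derivative of Im h, and its imaginary part that of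
   - Re h. *)
- have := @integrable_FTC2 _ (fun t => Im (h t))
    (fun t => Re (G (expi t)) * jacobi_weight lam eta t) _ _ pi2.
  rewrite h0 h1 subrr; apply.
  + exact: continuous_subspaceT.
  + move=> t /dh[_ d]; apply: (is_derive_eq d).
    by rewrite ImM ReM ImM /=; ring.
  + by move=> t tI; apply: cvgM; [exact: Gr|exact: jacobi_weight_continuous].
  + exact: (integrable_weighted wI).
- have := @integrable_FTC2 _ (fun t => - Re (h t))
    (fun t => Im (G (expi t)) * jacobi_weight lam eta t) _ _ pi2.
  rewrite h0 h1 subrr; apply.
  + by apply: continuous_subspaceT => t; apply: cvgN; exact: hr.
  + move=> t /dh[/is_deriveN d _]; apply: (is_derive_eq d).
    by rewrite ReM ReM ImM /=; ring.
  + by move=> t tI; apply: cvgM; [exact: Gi|exact: jacobi_weight_continuous].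
  + exact: (integrable_weighted wI).
Qed.

End CircleFunctional.

(** * Szego theory and differential relations for a Hermitian Toeplitz functional *)

Section ToeplitzFunctional.
Context {R : realType}.
Local Notation C := R[i].
Implicit Types (p q : {poly C}) (i j k m n : nat).

(* [ip p k] stands for the pairing <p, z^k>. *)
Variable ip : {poly C} -> nat -> C.
Hypothesis ipD : forall p q k, ip (p + q) k = ip p k + ip q k.
Hypothesis ipZ : forall a p k, ip (a *: p) k = a * ip p k.
Hypothesis ipX : forall p k, ip ('X * p) k.+1 = ip p k.
Hypothesis ip_conj : forall i j, (ip 'X^i j)^* = ip 'X^j i.

Variables (Phi : nat -> {poly C}) (N : nat -> C).
Hypothesis monicPhi : forall n, Phi n \is monic.
Hypothesis sizePhi : forall n, size (Phi n) = n.+1.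
Hypothesis N_neq0 : forall n, N n != 0.
Hypothesis N_conj : forall n, (N n)^* = N n.
Hypothesis orthPhi : forall n m,
  \sum_(k < m.+1) ((Phi m)`_k)^* * ip (Phi n) k = if n == m then N n else 0.

Lemma ip0 k : ip 0 k = 0.
Proof. by rewrite -(scale0r 0) ipZ mul0r. Qed.

Lemma ipN p k : ip (- p) k = - ip p k.
Proof. by rewrite -scaleN1r ipZ mulN1r. Qed.

Lemma ipB p q k : ip (p - q) k = ip p k - ip q k.
Proof. by rewrite ipD ipN. Qed.

Lemma ip_sum I (r : seq I) (P : pred I) (F : I -> {poly C}) k :
  ip (\sum_(i <- r | P i) F i) k = \sum_(i <- r | P i) ip (F i) k.
Proof. by apply: (big_morph (fun p => ip p k)) => [p q|]; rewrite ?ipD ?ip0. Qed.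

Lemma coef_lead_Phi n : (Phi n)`_n = 1.
Proof. by have := monicP (monicPhi n); rewrite lead_coefE sizePhi. Qed.

(** Triangularity: in <Phi n, Phi k> the powers below z^k contribute 0 by induction, and monicity
    leaves exactly <Phi n, z^k>. *)
Lemma ip_Phi n k : (k <= n)%N -> ip (Phi n) k = if n == k then N n else 0.
Proof.
elim/ltn_ind: k => k IH kn; rewrite -orthPhi big_ord_recr/= coef_lead_Phi conjC1 mul1r.
rewrite big1 ?add0r// => i _; rewrite IH ?(leq_trans (ltnW _) kn)//.
by rewrite gtn_eqF ?mulr0// (leq_trans _ kn).
Qed.

Lemma ip_Phi0 n k : (k < n)%N -> ip (Phi n) k = 0.
Proof. by move=> kn; rewrite ip_Phi ?gtn_eqF// ltnW. Qed.

Lemma ip_Phi_diag n : ip (Phi n) n = N n.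
Proof. by rewrite ip_Phi ?eqxx. Qed.

Lemma size_sub_lead p m : (size p <= m.+1)%N -> (size (p - p`_m *: Phi m)%R <= m)%N.
Proof.
move=> sp; apply/leq_sizeP => j; rewrite coefB coefZ.
rewrite leq_eqVlt => /predU1P[<-|mj]; first by rewrite coef_lead_Phi mulr1 subrr.
rewrite (nth_default _ (leq_trans sp mj)) [(Phi m)`_j]nth_default ?sizePhi//.
by rewrite mulr0 subrr.
Qed.

(** Nondegeneracy, by peeling off the top coefficient: after induction p is a multiple of the last
    [Phi m], and pairing with z^m kills the factor because [N m] is nonzero. *)
Lemma ip_eq0 p m : (size p <= m)%N -> (forall k, (k < m)%N -> ip p k = 0) -> p = 0.
Proof.
elim: m p => [p|m IH p sp p0].
  by rewrite size_poly_leq0 => /eqP.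
have pE : p = p`_m *: Phi m.
  apply/subr0_eq/IH => [|k km]; first exact: size_sub_lead.
  by rewrite ipB ipZ ip_Phi0// mulr0 subr0 p0// ltnW.
have /eqP := p0 m (leqnn _); rewrite pE ipZ ip_Phi_diag mulf_eq0 (negbTE (N_neq0 _)) orbF.
by move=> /eqP pm; rewrite pm scale0r.
Qed.

Lemma orth_below p m : (size p <= m.+1)%N -> (forall k, (k < m)%N -> ip p k = 0) ->
  p = (ip p m / N m) *: Phi m.
Proof.
move=> sp p0; have pE : p = p`_m *: Phi m.
  apply/subr0_eq/(@ip_eq0 _ m) => [|k km]; first exact: size_sub_lead.
  by rewrite ipB ipZ ip_Phi0// mulr0 subr0 p0.
by rewrite {2}pE ipZ ip_Phi_diag mulfK.
Qed.

Lemma ip_shift p d k : ip ('X^d * p) (d + k) = ip p k.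
Proof. by elim: d => [|d IH]; rewrite ?mul1r// exprS -mulrA addSn ipX. Qed.

Lemma ip_toeplitz i j k l : (i + l = k + j)%N -> ip 'X^i j = ip 'X^k l.
Proof.
by move=> e; rewrite -(ip_shift 'X^i l) -(ip_shift 'X^k j) -!exprD addnC e addnC [(l + j)%N]addnC.
Qed.

Local Notation Phis m := (reversed_poly m (Phi m)).

(** On the circle the reversed polynomial is z^m conj(Phi m), so its pairing with z^j is conj <Phi
    m, z^(m-j)>. The extra ['X] keeps the exponent natural at j = m + 1, the case that produces
    alpha. *)
Lemma ip_reversed m j : (j <= m.+1)%N ->
  ip (Phis m) j = (ip ('X * Phi m) (m.+1 - j))^*.
Proof.
move=> jm; rewrite /reversed_poly poly_def ip_sum.
have -> : 'X * Phi m = \sum_(i < m.+1) (Phi m)`_i *: 'X^(i.+1).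
  rewrite -{1}[Phi m]coefK sizePhi poly_def mulr_sumr; apply: eq_bigr => i _.
  by rewrite -scalerAr exprS.
rewrite ip_sum rmorph_sum/= [RHS](reindex_inj rev_ord_inj)/=; apply: eq_bigr => i _.
have im : (i <= m)%N by rewrite -ltnS.
rewrite !ipZ rmorphM/= ip_conj subSS; congr (_ * _); apply: ip_toeplitz.
by move: im jm => /=; lia.
Qed.

Lemma ip_reversed0 m j : (0 < j <= m)%N -> ip (Phis m) j = 0.
Proof.
move=> /andP[j0 jm]; rewrite ip_reversed; last exact: leqW.
by rewrite subSn// ipX ip_Phi0 ?conjC0// ltn_subrL j0 (leq_trans j0).
Qed.

Lemma ip_reversed_diag m : ip (Phis m) 0 = N m.
Proof. by rewrite ip_reversed// subn0 ipX ip_Phi_diag N_conj. Qed.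

Lemma size_reversed m : (size (Phis m) <= m.+1)%N.
Proof. exact: size_poly. Qed.

Lemma coef0_reversed m : (Phis m)`_0 = 1.
Proof. by rewrite coef_poly/= subn0 coef_lead_Phi conjC1. Qed.

Lemma orth_above p m : (size p <= m.+1)%N ->
  (forall k, (0 < k <= m)%N -> ip p k = 0) -> p = p`_0 *: Phis m.
Proof.
move=> sp p0; apply: subr0_eq; set q := p - _.
have q0 : q`_0 = 0 by rewrite coefB coefZ coef0_reversed mulr1 subrr.
have qE : q = 'X * drop_poly 1 q.
  apply/polyP => -[|i]; by rewrite coefXM//= coef_drop_poly addn1.
suff r0 : drop_poly 1 q = 0 by rewrite qE r0 mulr0.
apply: (@ip_eq0 _ m) => [|k km].
  rewrite size_drop_poly leq_subLR add1n (leq_trans (size_polyD _ _))// size_polyN.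
  by rewrite geq_max sp (leq_trans (size_scale_leq _ _))// size_reversed.
by rewrite -ipX -qE ipB ipZ p0 ?km// ip_reversed0 ?km// mulr0 subrr.
Qed.

Local Notation alpha m := (verblunsky Phi m).

(** Both Phi (m+1) and z Phi m are monic and orthogonal to z, ..., z^m, so their difference is a
    multiple of the reversed polynomial, with factor its value at 0. *)
Lemma szego m : Phi m.+1 = 'X * Phi m - (alpha m)^* *: Phis m.
Proof.
have -> : (alpha m)^* = - (Phi m.+1 - 'X * Phi m)`_0.
  by rewrite coefB coefXM/= subr0 /verblunsky rmorphN/= conjCK horner_coef0.
apply/eqP; rewrite scaleNr opprK addrC -subr_eq; apply/eqP; apply: orth_above.
  apply/leq_sizeP => j; rewrite coefB coefXM leq_eqVlt => /predU1P[<-|mj].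
    by rewrite /= !coef_lead_Phi subrr.
  by case: j mj => // j mj; rewrite /= !nth_default ?subrr ?sizePhi.
move=> [//|k] /andP[_ km]; rewrite ipB ipX !ip_Phi0 ?subrr// ltnS ltnW.
Qed.

Lemma ip_X_Phi0 m : ip ('X * Phi m) 0 = (alpha m)^* * N m.
Proof.
have := ip_Phi0 (ltn0Sn m); rewrite szego ipB ipZ ip_reversed_diag.
by move/eqP; rewrite subr_eq0 => /eqP.
Qed.

Lemma ip_reversed_last m : ip (Phis m) m.+1 = alpha m * N m.
Proof. by rewrite ip_reversed// subnn ip_X_Phi0 rmorphM/= conjCK N_conj. Qed.

Lemma norm_recurrence m : N m.+1 = (1 - `|alpha m| ^+ 2) * N m.
Proof.
rewrite -[LHS]ip_Phi_diag szego ipB ipZ ipX ip_Phi_diag ip_reversed_last normCK; ring.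
Qed.

Variable b : C.
Hypothesis ip_pearson : forall p k, ip ('X * ((1 - 'X) * p^`())) k =
  (k%:R + b^*) * ip p k - (k%:R - 1 - b) * ip ('X * p) k.

Local Notation c n := (b^* + n%:R).

Lemma coef_deriv_onem p j :
  ((1 - 'X) * p^`())`_j = p`_j.+1 *+ j.+1 - p`_j *+ j.
Proof. by rewrite mulrBl mul1r coefB coefXM !coef_deriv; case: j => [|j]; rewrite ?mulr0n. Qed.

(** Adding (m+1) Phi (m+1) cancels the leading term of - z Phi', which brings the degree down to m;
    Pearson's relation gives orthogonality to lower powers. The constant is c (m+1) N (m+1) / N
    m. *)
Lemma deriv_Phi m : (1 - 'X) * (Phi m.+1)^`() + (m.+1)%:R *: Phi m.+1 =
  (c m.+1 * (1 - `|alpha m| ^+ 2)) *: Phi m.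
Proof.
set P := LHS.
(* Pearson's relation concerns z (1 - z) p', so [P] paired with z^j is first rewritten as z P paired
   with z^(j+1). *)
have ipP j : ip P j = (j.+1%:R + b^*) * ip (Phi m.+1) j.+1 - (j%:R - b - m.+1%:R) * ip (Phi m.+1) j.
  rewrite -ipX mulrDr ipD ip_pearson -scalerAr ipZ ipX; ring.
have -> : P = (ip P m / N m) *: Phi m.
  apply: orth_below => [|j jm]; last by rewrite ipP !ip_Phi0 ?mulr0 ?subrr// ltnW.
  apply/leq_sizeP => j; rewrite coefD coefZ coef_deriv_onem leq_eqVlt => /predU1P[<-|mj].
    rewrite coef_lead_Phi nth_default ?sizePhi//; ring.
  rewrite !nth_default ?sizePhi ?mulr0 ?mul0rn ?subrr ?addr0//; exact: ltnW.
rewrite ipP ip_Phi_diag ip_Phi0// mulr0 subr0 norm_recurrence; congr (_ *: _).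
field; exact: N_neq0.
Qed.

(** Subtracting b times the reversed polynomial turns the coefficient j - b of Pearson's relation
    into j. That factor removes the case j = 0, the only pairing of index at most m that does not
    vanish. *)
Lemma deriv_reversed m : (1 - 'X) * (Phis m)^`() - b *: Phis m = (c m.+1 * alpha m) *: Phi m.
Proof.
set P := LHS.
have ipP j : ip P j = (j.+1%:R + b^*) * ip (Phis m) j.+1 - j%:R * ip (Phis m) j.
  rewrite -ipX mulrBr ipB ip_pearson -scalerAr ipZ ipX; ring.
have -> : P = (ip P m / N m) *: Phi m.
  apply: orth_below => [|j jm].
    apply/leq_sizeP => j mj; rewrite coefB coefZ coef_deriv_onem.
    have sm := leq_trans (size_reversed m) mj.
    by rewrite !(nth_default _ sm, nth_default _ (leqW sm)) mulr0 !mul0rn !subrr.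
  rewrite ipP ip_reversed0 ?jm// mulr0 sub0r; case: j jm => [|j] jm; first by rewrite mul0r oppr0.
  by rewrite ip_reversed0 ?mulr0 ?oppr0//= ltnW.
rewrite ipP ip_reversed_last.
have -> : m%:R * ip (Phis m) m = 0.
  by case: m {P ipP} => [|m]; rewrite ?mul0r// ip_reversed0 ?mulr0//= leqnn.
congr (_ *: _); field; exact: N_neq0.
Qed.

(** Multiplication by z replaces Phi m by z Phi m, which the Szego recurrence expresses through Phi
    (m+1) and the reversed polynomial; this closes the system. *)
Lemma deriv_Phi_system m :
  'X * ((1 - 'X) * (Phi m.+1)^`()) =
    (- m.+1%:R) *: ('X * Phi m.+1) + (c m.+1 * (1 - `|alpha m| ^+ 2)) *: Phi m.+1
    + (c m.+1 * (1 - `|alpha m| ^+ 2) * (alpha m)^*) *: Phis m.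
Proof.
have /(canRL (addrK _)) -> := deriv_Phi m.
have E : 'X * Phi m = Phi m.+1 + (alpha m)^* *: Phis m by rewrite szego subrK.
by rewrite mulrBr -!scalerAr E scalerDr scalerA scaleNr addrC addrA.
Qed.

Lemma deriv_reversed_system m :
  'X * ((1 - 'X) * (Phis m)^`()) =
    b *: ('X * Phis m) + (c m.+1 * `|alpha m| ^+ 2) *: Phis m + (c m.+1 * alpha m) *: Phi m.+1.
Proof.
have /(canRL (subrK _)) -> := deriv_reversed m.
have E : 'X * Phi m = Phi m.+1 + (alpha m)^* *: Phis m by rewrite szego subrK.
rewrite mulrDr -!scalerAr E scalerDr scalerA normCK mulrA.
by rewrite addrC [X in _ + X = _]addrC addrA.
Qed.

End ToeplitzFunctional.

(** * Calculus on the circle, and contour integrals as integrals against the weight *)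

Section CircleCalculus.
Context {R : realType}.
Local Notation C := R[i].
Local Notation Re := complex.Re.
Local Notation Im := complex.Im.
Local Notation mu := (@lebesgue_measure R).
Implicit Types (F G : C -> C) (z : C) (p q : {poly C}).

Lemma norm1_neq0 z : `|z| = 1 -> z != 0.
Proof. by move=> z1; rewrite -normr_eq0 z1 oner_neq0. Qed.

Lemma norm1_sub_neq0 (w z : C) : `|w| = 1 -> `|z| != 1 -> w - z != 0.
Proof. by move=> w1; apply: contraNneq => /subr0_eq <-; rewrite w1. Qed.

Lemma circ_continuousV F : (forall z, `|z| = 1 -> F z != 0) ->
  circ_continuous F -> circ_continuous (fun z => (F z)^-1).
Proof. by move=> F0; apply: ccontinuousV => t; rewrite F0// norm_expi. Qed.

Lemma circ_derive_cst a : circ_derive (fun=> a : C) (fun=> 0).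
Proof. by move=> t; rewrite mulr0; exact: is_cderive_cst. Qed.

Lemma circ_derive_id : circ_derive (@id C) (fun=> 1).
Proof. by move=> t; rewrite mulr1; exact: is_cderive_expi. Qed.

Lemma circ_deriveD F F' G G' : circ_derive F F' -> circ_derive G G' ->
  circ_derive (fun z => F z + G z) (fun z => F' z + G' z).
Proof. by move=> dF dG t; rewrite mulrDr; apply: is_cderiveD. Qed.

Lemma circ_deriveM F F' G G' : circ_derive F F' -> circ_derive G G' ->
  circ_derive (fun z => F z * G z) (fun z => F' z * G z + F z * G' z).
Proof.
move=> dF dG t; apply: (is_cderive_eq (is_cderiveM (dF t) (dG t))); ring.
Qed.

Lemma circ_deriveV F F' : (forall z, `|z| = 1 -> F z != 0) -> circ_derive F F' ->
  circ_derive (fun z => (F z)^-1) (fun z => - F' z / F z ^+ 2).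
Proof.
move=> F0 dF t; have Ft := F0 _ (norm_expi t).
by apply: (is_cderive_eq (is_cderiveV Ft (dF t))); field.
Qed.

Lemma circ_derive_horner p : circ_derive (horner p) (horner p^`()).
Proof.
elim/poly_ind: p => [|p c IH].
  rewrite deriv0 (_ : horner 0 = fun=> 0); last by apply/funext => z; rewrite horner0.
  exact: circ_derive_cst.
rewrite (_ : horner (_ + _) = fun z => p.[z] * z + c); last first.
  by apply/funext => z; rewrite hornerMXaddC.
rewrite (_ : horner (_^`()) = fun z => p^`().[z] * z + p.[z] * 1 + 0); last first.
  by apply/funext => z; rewrite derivMXaddC hornerD hornerMX mulr1 addr0 addrC.
by apply: circ_deriveD (circ_derive_cst c); exact: circ_deriveM circ_derive_id.
Qed.

Lemma circ_derive_exprn n : circ_derive (fun z => z ^+ n) (fun z => z ^+ n.-1 *+ n).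
Proof.
have := @circ_derive_horner 'X^n.
rewrite derivXn (_ : horner 'X^n = fun z => z ^+ n); last by apply/funext => z; rewrite hornerXn.
by rewrite (_ : horner _ = fun z => z ^+ n.-1 *+ n)//; apply/funext => z; rewrite hornerMn hornerXn.
Qed.

Lemma circ_derive_continuous F F' : circ_derive F F' -> circ_continuous F.
Proof. exact: is_cderive_continuous. Qed.

Lemma circ_continuous_cst a : circ_continuous (fun=> a : C).
Proof. exact: ccontinuous_cst. Qed.

Lemma circ_continuous_id : circ_continuous (@id C).
Proof. exact: (circ_derive_continuous circ_derive_id). Qed.

Lemma circ_continuousD F G : circ_continuous F -> circ_continuous G ->
  circ_continuous (fun z => F z + G z).
Proof. exact: ccontinuousD. Qed.

Lemma circ_continuousM F G : circ_continuous F -> circ_continuous G ->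
  circ_continuous (fun z => F z * G z).
Proof. exact: ccontinuousM. Qed.

Lemma circ_continuousN F : circ_continuous F -> circ_continuous (fun z => - F z).
Proof. exact: ccontinuousN. Qed.

Lemma circ_continuous_horner p : circ_continuous (horner p).
Proof. exact: (circ_derive_continuous (circ_derive_horner p)). Qed.

Lemma circ_continuous_exprn n : circ_continuous (fun z => z ^+ n).
Proof. exact: (circ_derive_continuous (circ_derive_exprn n)). Qed.

Lemma circ_continuous_exprVn n : circ_continuous (fun z => (z ^+ n)^-1).
Proof.
apply: circ_continuousV (circ_continuous_exprn n) => z /norm1_neq0.
exact: expf_neq0.
Qed.

Lemma circ_continuous_cauchy z : `|z| != 1 -> circ_continuous (fun t => (t - z)^-1).
Proof.
move=> z1; apply: circ_continuousV => [t t1|]; first exact: norm1_sub_neq0.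
exact: circ_continuousD circ_continuous_id (circ_continuous_cst _).
Qed.

Variables (lam eta : R).
Local Notation b := ((lam +i* eta)%C : C).
Local Notation w := (jacobi_weight lam eta).
Local Notation J := (weighted_integral lam eta).

(** The closed form of the weight is known on the open arc only, and the values at z = 1 may differ.
    Dropping the endpoints as a null set is what calls for measurability of the integrands. *)
Lemma circle_integral_weighted F G : circ_continuous F ->
  (forall z, `|z| = 1 -> G z * ('i * z) = F z * circle_weight b z) ->
  circle_integral G = J F.
Proof.
move=> [cFr cFi] GF.
have pt t : t \in `]0, 2 * pi[ ->
    G (expi t) * ('i * expi t) = F (expi t) * (w t)%:C%C.
  by move=> tI; rewrite GF ?norm_expi// circle_weight_expi.
have mR (g : R -> R) : continuous g -> measurable_fun `]0, 2 * pi[ (fun t => g t * w t).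
  move=> cg; apply: measurable_funM; last exact: measurable_jacobi_weight.
  by apply: (@measurable_funS _ _ _ _ setT) => //; exact: continuous_measurable_fun.
have eqI (g h : R -> R) : measurable_fun `]0, 2 * pi[ h ->
    (forall t, t \in `]0, 2 * pi[ -> g t = h t) ->
    \int[mu]_(t in `[0, 2 * pi]) g t = \int[mu]_(t in `[0, 2 * pi]) h t.
  move=> /measurable_EFinP mh gh.
  have mg : measurable_fun `]0, 2 * pi[ (fun t => (g t)%:E).
    by apply: (eq_measurable_fun _ _ mh) => t; rewrite inE/= => /gh ->.
  have hE := @integral_itv_bndoo _ 0 (2 * pi) (fun t => (h t)%:E) true false mh.
  have gE := @integral_itv_bndoo _ 0 (2 * pi) (fun t => (g t)%:E) true false mg.
  rewrite /Rintegral hE gE; congr fine.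
  by apply: eq_integral => t; rewrite inE/= => /gh ->.
rewrite /circle_integral /weighted_integral /cRintegral; congr (_ +i* _)%C.
- rewrite (eqI _ (fun t => Re (F (expi t)) * w t)).
  + by apply: eq_Rintegral => t _; rewrite ReM/=; ring.
  + exact: mR.
  + by move=> t /pt ->; rewrite ReM/=; ring.
- rewrite (eqI _ (fun t => Im (F (expi t)) * w t)).
  + by apply: eq_Rintegral => t _; rewrite ImM/=; ring.
  + exact: mR.
  + by move=> t /pt ->; rewrite ImM/=; ring.
Qed.

Lemma mu_integral_weighted F : circ_continuous F ->
  mu_integral (circle_weight b) F = J F.
Proof.
move=> cF; apply: circle_integral_weighted => // z /norm1_neq0 z0.
by field; rewrite neq0Ci z0.
Qed.

(* A nonintegrable weight would have total mass fine +oo = 0. *)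
Lemma weight_integrable_of_mass : J (fun=> 1) != 0 -> weight_integrable lam eta.
Proof.
move=> J0; apply/integrableP; split.
  by apply/measurable_EFinP; exact: measurable_jacobi_weight.
rewrite ltNge leye_eq; apply/negP => /eqP winf; move/eqP: J0; apply.
have w0 t : `|(EFin \o w) t|%E = (w t)%:E by rewrite /= ger0_norm ?jacobi_weight_ge0.
have winf1 : (\int[mu]_(t in `[0%R, (2 * pi)%R]) (w t)%:E)%E = +oo%E.
  by rewrite -winf; apply: eq_integral => t _; rewrite w0.
apply: complex_eqP; rewrite ?Re_weighted ?Im_weighted.
- by under eq_Rintegral do rewrite mul1r; rewrite /Rintegral winf1.
- by under eq_Rintegral do rewrite mul0r; rewrite /Rintegral integral0.
Qed.

End CircleCalculus.

(** * Moments, Cauchy transforms and their Pearson relations *)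

Section Moments.
Context {R : realType}.
Local Notation C := R[i].
Implicit Types (F G : C -> C) (z : C) (p q : {poly C}).

Variables (lam eta : R).
Local Notation b := ((lam +i* eta)%C : C).
Local Notation J := (weighted_integral lam eta).
Hypothesis wI : weight_integrable lam eta.
Hypothesis lam_gt : - (1 / 2) < lam.

(* In the paper's notation [moment p k] is <p, z^k>, and [cauchy p k z] is
   2 pi times the transform with weight nu(t) / t^(k+1): one power of t comes
   from dt = i t dtheta. [dcauchy] is the derivative of [cauchy] in z. *)
Definition moment p k : C := J (fun t => p.[t] / t ^+ k).

Definition cauchy p k z : C := J (fun t => p.[t] / t ^+ k / (t - z)).

Definition dcauchy p k z : C := J (fun t => p.[t] / t ^+ k / (t - z) ^+ 2).

Lemma circ_continuous_moment p k : circ_continuous (fun t => p.[t] / t ^+ k : C).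
Proof.
exact: circ_continuousM (circ_continuous_horner p) (circ_continuous_exprVn k).
Qed.

Lemma circ_continuous_cauchy_kernel p k z : `|z| != 1 ->
  circ_continuous (fun t => p.[t] / t ^+ k / (t - z) : C).
Proof.
move=> z1.
exact: circ_continuousM (circ_continuous_moment p k) (circ_continuous_cauchy z1).
Qed.

Lemma circ_continuous_dcauchy_kernel p k z : `|z| != 1 ->
  circ_continuous (fun t => p.[t] / t ^+ k / (t - z) ^+ 2 : C).
Proof.
move=> z1; apply: circ_continuousM (circ_continuous_moment p k) _.
apply: circ_continuousV => [t t1|]; first by rewrite expf_neq0// norm1_sub_neq0.
have c : circ_continuous (fun t : C => t - z).
  exact: circ_continuousD circ_continuous_id (circ_continuous_cst _).
exact: (circ_continuousM c c).
Qed.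

Lemma momentD p q k : moment (p + q) k = moment p k + moment q k.
Proof.
rewrite -(weightedD wI (circ_continuous_moment p k) (circ_continuous_moment q k)).
by apply: eq_weighted => t _; rewrite hornerD mulrDl.
Qed.

Lemma momentZ a p k : moment (a *: p) k = a * moment p k.
Proof.
rewrite -(weightedZ wI a (circ_continuous_moment p k)).
by apply: eq_weighted => t _; rewrite hornerZ mulrA.
Qed.

Lemma momentB p q k : moment (p - q) k = moment p k - moment q k.
Proof. by rewrite -scaleN1r momentD momentZ mulN1r. Qed.

Lemma momentX p k : moment ('X * p) k.+1 = moment p k.
Proof.
apply: eq_weighted => t /norm1_neq0 t0; rewrite hornerM hornerX exprS.
by field; rewrite t0 expf_neq0.
Qed.

Lemma moment_conj i j : (moment 'X^i j)^* = moment 'X^j i.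
Proof.
rewrite -(weighted_conj wI (circ_continuous_moment _ _)).
apply: eq_weighted => t t1; have t0 := norm1_neq0 t1.
have tc : t^* = t^-1 by rewrite invC_norm t1 expr1n invr1 mul1r.
by rewrite !hornerXn rmorphM fmorphV !rmorphXn/= tc !exprVn invrK mulrC.
Qed.

Lemma cauchyD p q k z : `|z| != 1 -> cauchy (p + q) k z = cauchy p k z + cauchy q k z.
Proof.
move=> z1; have cc r := circ_continuous_cauchy_kernel r k z1.
rewrite -(weightedD wI (cc p) (cc q)).
by apply: eq_weighted => t _; rewrite hornerD !mulrDl.
Qed.

Lemma cauchyZ a p k z : `|z| != 1 -> cauchy (a *: p) k z = a * cauchy p k z.
Proof.
move=> z1; rewrite -(weightedZ wI a (circ_continuous_cauchy_kernel p k z1)).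
by apply: eq_weighted => t _; rewrite hornerZ !mulrA.
Qed.

(** From t / (t - z) = 1 + z / (t - z); the first term yields the moment. *)
Lemma cauchyX p k z : `|z| != 1 -> cauchy ('X * p) k z = z * cauchy p k z + moment p k.
Proof.
move=> z1; have cc := circ_continuous_cauchy_kernel p k z1.
rewrite -(weightedZ wI z cc) -(weightedD wI _ (circ_continuous_moment p k)); last first.
  exact: circ_continuousM (circ_continuous_cst z) cc.
apply: eq_weighted => t t1; have tz := norm1_sub_neq0 t1 z1.
have t0 : t ^+ k != 0 by rewrite expf_neq0// norm1_neq0.
by rewrite hornerM hornerX; field; rewrite t0.
Qed.

Lemma circ_derive_moment p k :
  circ_derive (fun t : C => p.[t] / t ^+ k)
    (fun t => (p^`().[t] - k%:R * p.[t] / t) / t ^+ k).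
Proof.
have t0 (z : C) : `|z| = 1 -> z ^+ k != 0.
  by move=> z1; rewrite expf_neq0// norm1_neq0.
have d := circ_deriveM (circ_derive_horner p) (circ_deriveV t0 (@circ_derive_exprn R k)).
move=> s; apply: (is_cderive_eq (d s)); congr (_ * _).
have e0 := expi_neq0 s; have ek : expi s ^+ k != 0 by rewrite expf_neq0.
case: k {d t0} ek => [|k] ek; first by rewrite mulr0n expr0; field.
by rewrite -mulr_natr /= [expi s ^+ k.+1]exprSr; field; rewrite e0 expf_neq0.
Qed.

Lemma moment_pearson p k : moment ('X * ((1 - 'X) * p^`())) k =
  (k%:R + b^*) * moment p k - (k%:R - 1 - b) * moment ('X * p) k.
Proof.
apply: subr0_eq; rewrite -!momentZ -!momentB.
rewrite -(weighted_pearson wI lam_gt (circ_derive_moment p k)); last first.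
  apply: circ_continuousM _ (circ_continuous_exprVn k).
  apply: circ_continuousD (circ_continuous_horner _) _; apply: circ_continuousN.
  apply: circ_continuousM _ (circ_continuousV norm1_neq0 circ_continuous_id).
  exact: circ_continuousM (circ_continuous_cst _) (circ_continuous_horner p).
apply: eq_weighted => t t1; have t0 := norm1_neq0 t1.
have tk : t ^+ k != 0 by rewrite expf_neq0.
by rewrite !(hornerM, hornerD, hornerN, hornerX, hornerZ, hornerC); field; rewrite t0 tk.
Qed.

(* Pearson's identity for p t^-m / (t - z), with t (1 - t) expanded at t = z. *)
Lemma cauchy_pearson p m z : `|z| != 1 ->
  z * (1 - z) * dcauchy p m z = cauchy ('X * ((1 - 'X) * p^`())) m z
    + ((m.+1%:R - b) * z - m.+1%:R - b^*) * cauchy p m z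
    + (m%:R - b) * moment p m.
Proof.
move=> z1.
set p2 := 'X * ((1 - 'X) * p^`()).
have ck q := circ_continuous_cauchy_kernel q m z1.
have cd := circ_continuous_dcauchy_kernel p m z1.
have ct : circ_continuous (fun t : C => t - z).
  exact: circ_continuousD circ_continuous_id (circ_continuous_cst _).
have tz t : `|t| = 1 -> t - z != 0 by move=> t1; exact: norm1_sub_neq0.
have dt : circ_derive (fun t : C => t - z) (fun=> 1 + 0).
  exact: circ_deriveD circ_derive_id (circ_derive_cst _).
set d := (m.+1%:R - b) * z - m.+1%:R - b^*.
apply/esym/subr0_eq; rewrite -mulNr.
rewrite -(weightedZ wI d (ck p)) -(weightedZ wI (m%:R - b) (circ_continuous_moment p m)).
rewrite -(weightedZ wI (- (z * (1 - z))) cd).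
have cZ a F : circ_continuous F -> circ_continuous (fun t => a * F t).
  exact: circ_continuousM (circ_continuous_cst a).
have c1 := cZ d _ (ck p); have c2 := cZ (m%:R - b) _ (circ_continuous_moment p m).
have c3 := cZ (- (z * (1 - z))) _ cd.
rewrite -(weightedD wI (ck p2) c1) -(weightedD wI (circ_continuousD (ck p2) c1) c2).
rewrite -(weightedD wI (circ_continuousD (circ_continuousD (ck p2) c1) c2) c3).
have := weighted_pearson wI lam_gt (circ_deriveM (circ_derive_moment p m) (circ_deriveV tz dt)).
move=> <-; last first.
  have cm := circ_continuous_moment p m.
  have ci := circ_continuousV norm1_neq0 (@circ_continuous_id R).
  have cz := circ_continuous_cauchy z1.
  apply: circ_continuousD.
    apply: circ_continuousM _ cz; apply: circ_continuousM _ (circ_continuous_exprVn m).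
    apply: circ_continuousD (circ_continuous_horner _) _; apply: circ_continuousN.
    by apply: circ_continuousM _ ci; apply: cZ; exact: circ_continuous_horner.
  apply: circ_continuousM cm _; apply: circ_continuousM (circ_continuous_cst _) _.
  apply: circ_continuousV (circ_continuousM ct ct) => t /tz tz0; exact: mulf_neq0.
apply: eq_weighted => t t1; have t0 := norm1_neq0 t1; have tz0 := tz t t1.
have tk : t ^+ m != 0 by rewrite expf_neq0.
by rewrite /p2 /d !(hornerM, hornerD, hornerN, hornerX, hornerZ, hornerC) -natr1; field;
   rewrite t0 tz0 tk.
Qed.

End Moments.

(** * Complex differentiability of the Cauchy transform off the circle *)

Section CauchyDerivative.
Context {R : realType}.
Local Notation C := R[i].
Implicit Types (F G : C -> C) (z : C) (p q : {poly C}).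
Variables (lam eta : R).
Local Notation J := (weighted_integral lam eta).
Hypothesis wI : weight_integrable lam eta.

Lemma weightedB F G : circ_continuous F -> circ_continuous G ->
  J (fun z => F z - G z) = J F - J G.
Proof.
move=> cF cG; rewrite -[- J G]mulN1r -(weightedZ wI _ cG) -(weightedD wI cF).
  by apply: eq_weighted => z _; rewrite mulN1r.
exact: circ_continuousM (circ_continuous_cst _) cG.
Qed.

Lemma circ_continuous_sum n (F : nat -> C -> C) : (forall i, circ_continuous (F i)) ->
  circ_continuous (fun z => \sum_(i < n) F i z).
Proof.
move=> cF; elim: n => [|n IH].
  have -> : (fun z => \sum_(i < 0) F i z) = fun=> 0 by apply/funext => z; rewrite big_ord0.
  exact: circ_continuous_cst.
have -> : (fun z => \sum_(i < n.+1) F i z) = fun z => \sum_(i < n) F i z + F n z.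
  by apply/funext => z; rewrite big_ord_recr.
exact: circ_continuousD IH (cF n).
Qed.

Lemma weighted_sum n (F : nat -> C -> C) : (forall i, circ_continuous (F i)) ->
  J (fun z => \sum_(i < n) F i z) = \sum_(i < n) J (F i).
Proof.
move=> cF; elim: n => [|n IH].
  rewrite big_ord0; apply: etrans (etrans (weightedZ wI 0 (circ_continuous_cst 0)) (mul0r _)).
  by apply: eq_weighted => z _; rewrite big_ord0 mul0r.
rewrite big_ord_recr/= -IH -(weightedD wI (circ_continuous_sum n cF) (cF n)).
by apply: eq_weighted => z _; rewrite big_ord_recr.
Qed.

Lemma circ_continuous_conj F : circ_continuous F -> circ_continuous (fun z => (F z)^*).
Proof.
move=> [Fr Fi]; split.
- have -> : (fun s => complex.Re (F (expi s))^*) = fun s => complex.Re (F (expi s)).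
    by apply/funext => s; case: (F _).
  exact: Fr.
- have -> : (fun s => complex.Im (F (expi s))^*) = fun s => - complex.Im (F (expi s)).
    by apply/funext => s; case: (F _).
  by move=> t; apply: cvgN; exact: Fi.
Qed.

Lemma horner_circ_bounded p : exists M : R, forall t : C, `|t| = 1 -> `|p.[t]| <= M%:C%C.
Proof.
exists (\sum_(i < size p) complex.Re `|p`_i|) => t t1.
rewrite horner_coef rmorph_sum (le_trans (ler_norm_sum _ _ _))//.
apply: ler_sum => i _; rewrite normrM normrX t1 expr1n mulr1.
by rewrite -[X in X <= _](RRe_real (normr_real _)).
Qed.

Lemma dist_circle z : `|z| != 1 ->
  exists2 d : R, 0 < d & forall t : C, `|t| = 1 -> d%:C%C <= `|t - z|.
Proof.
move=> z1; have /complex_realP[d dE] : `| 1 - `|z| | \is Num.real by exact: normr_real.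
exists d.
  by rewrite -(ltcR 0) -dE normr_gt0 subr_eq0 eq_sym.
by move=> t t1; rewrite -dE -t1 ler_dist_dist.
Qed.

(* The error of the difference quotient is h times the integral of
   p(t) t^-k (t - z)^-2 (t - z - h)^-1, whose kernel is bounded near z. *)
Lemma is_derive_cauchy (f : C^o -> C^o) (a : C) p k z : `|z| != 1 ->
  (forall y, `|y| != 1 -> f y = a * cauchy lam eta p k y) ->
  is_derive (z : C^o) (1 : C^o) f (a * dcauchy lam eta p k z).
Proof.
move=> z1 fE; have [d d0 dz] := dist_circle z1.
have [M pM] := horner_circ_bounded p.
have dC : 0 < d%:C%C :> C by rewrite (ltcR 0).
have d2C : 0 < (d / 2)%:C%C :> C by rewrite (ltcR 0) divr_gt0.
(* M bounds p on the circle, d^-2 bounds (t - z)^-2, and (d/2)^-1 bounds (t - z - h)^-1 once |h| <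
   d/2; the prefactor is that of [norm_weighted]. *)
pose B := 2 * weight_mass lam eta * (M * (d^-1 ^+ 2) * (d / 2)^-1).
have err h : h != 0 -> `|h| < (d / 2)%:C%C ->
    `|a * dcauchy lam eta p k z - h^-1 * (f (h + z) - f z)| <= `|a| * `|h| * B%:C%C.
  move=> h0 hd.
  have far t : `|t| = 1 -> (d / 2)%:C%C <= `|t - (h + z)|.
    move=> t1; rewrite opprD addrA addrAC.
    apply: le_trans (lerB_dist _ _); rewrite lerBrDr.
    apply: le_trans (dz t t1); rewrite [X in _ <= X%:C%C](splitr d) rmorphD lerD2l.
    exact: ltW.
  (* Were h + z on the circle, taking t = h + z in [far] would give d/2 <= 0. *)
  have hz1 : `|h + z| != 1.
    apply/negP => /eqP /far; by rewrite subrr normr0 (lt_geF d2C).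
  rewrite !fE// /dcauchy /cauchy.
  set S1 := J _; set S2 := J _; set S3 := J _.
  have c1 := circ_continuous_dcauchy_kernel p k z1.
  have c2 := circ_continuous_cauchy_kernel p k hz1.
  have c3 := circ_continuous_cauchy_kernel p k z1.
  pose K t := p.[t] / t ^+ k / (t - z) ^+ 2 / (t - (h + z)).
  have cK : circ_continuous K.
    exact: circ_continuousM c1 (circ_continuous_cauchy hz1).
  have -> : a * S1 - h^-1 * (a * S2 - a * S3) = a * (- h) * J K.
    (* Integrated form of (t-z)^-2 = h^-1 ((t-z-h)^-1 - (t-z)^-1) - h (t-z)^-2 (t-z-h)^-1. *)
    have -> : S1 = h^-1 * (S2 - S3) - h * J K; last by ring.
    rewrite -(weightedB c2 c3) -!weightedZ//; last first.
      exact: circ_continuousD c2 (circ_continuousN c3).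
    rewrite -weightedB; last 2 first.
    - apply: circ_continuousM (circ_continuous_cst _) _.
      exact: circ_continuousD c2 (circ_continuousN c3).
    - exact: circ_continuousM (circ_continuous_cst _) cK.
    apply: eq_weighted => t t1.
    have tz := norm1_sub_neq0 t1 z1; have thz := norm1_sub_neq0 t1 hz1.
    have tk : t ^+ k != 0 by rewrite expf_neq0// norm1_neq0.
    by rewrite /K; field; rewrite h0 tz thz tk.
  rewrite !normrM normrN; apply: ler_wpM2l; first by rewrite mulr_ge0.
  apply: norm_weighted => // t t1.
  rewrite /K !normrM !normfV !normrX t1 expr1n invr1 mulr1.
  have -> : (M * d^-1 ^+ 2 * (d / 2)^-1)%:C%C = M%:C%C * d%:C%C^-1 ^+ 2 * (d / 2)%:C%C^-1.
    by rewrite 2!rmorphM/= rmorphXn/= !fmorphV.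
  have i1 : `|t - z|^-1 <= d%:C%C^-1.
    by rewrite lef_pV2 ?posrE ?dz// (lt_le_trans dC)// dz.
  have i2 : `|t - (h + z)|^-1 <= (d / 2)%:C%C^-1.
    by rewrite lef_pV2 ?posrE ?far// (lt_le_trans d2C)// far.
  have i0 : 0 <= `|t - z|^-1 ^+ 2 by rewrite exprn_ge0// invr_ge0.
  rewrite -exprVn; apply: ler_pM i2.
  - exact: mulr_ge0.
  - by rewrite invr_ge0.
  apply: ler_pM => //; first exact: pM.
  by rewrite lerXn2r// ?nnegrE ?invr_ge0 ?(ltW dC).
have cv : h^-1 *: (f (h *: (1 : C^o) + z) - f z) @[h --> (0 : (C : numFieldType))^'] -->
    (a * dcauchy lam eta p k z : C^o).
  apply/cvgrPdist_le => e e0.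
  (* The summand 1 keeps the denominator positive even when a or B is 0. *)
  have A0 : 0 < `|a| * `|B%:C%C| + 1 :> C by rewrite ltr_wpDl// mulr_ge0.
  near=> h.
  have h0 : h != 0 by near: h; exact: (@nbhs_dnbhs_neq C^o 0).
  have hd : `|h| < (d / 2)%:C%C.
    by near: h; exact: (@dnbhs0_lt _ C^o).
  have he : `|h| <= e / (`|a| * `|B%:C%C| + 1).
    by near: h; apply: (@dnbhs0_le _ C^o); rewrite divr_gt0.
  rewrite /GRing.scale/= mulr1; apply: (le_trans (err h h0 hd)).
  rewrite mulrAC mulrC (le_trans _ (_ : `|h| * (`|a| * `|B%:C%C| + 1) <= e))//.
    apply: ler_wpM2l => //; apply: ler_wpDr => //; apply: ler_wpM2l => //.
    by rewrite real_ler_norm// complex_real.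
  by rewrite -ler_pdivlMr.
split; first by apply/cvg_ex; exists (a * dcauchy lam eta p k z).
exact: (cvg_lim (@norm_hausdorff _ _) cv).
Unshelve. all: by end_near. Qed.

End CauchyDerivative.

(** * The given integrals in terms of moments and angular Cauchy transforms *)

Section CauchyTransform.
Context {R : realType}.
Local Notation C := R[i].
Variables (lam eta : R).
Local Notation b := ((lam +i* eta)%C : C).
Implicit Types (p : {poly C}) (z : C).

Lemma cauchy_transformE p m z : weight_integrable lam eta -> `|z| != 1 ->
  cauchy_transform (circle_weight b) p m.+1 z =
  (2 * pi%:C%C)^-1 * cauchy lam eta p m z.
Proof.
move=> wI z1; have cc := circ_continuous_cauchy_kernel p m z1.
rewrite /cauchy_transform.
rewrite (@circle_integral_weighted _ lam eta (fun t => 'i * (p.[t] / t ^+ m / (t - z)))).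
- rewrite (weightedZ wI _ cc) [in LHS]invfM mulrA; congr (_ * _).
  by rewrite -mulrA mulVf ?neq0Ci// mulr1.
- exact: circ_continuousM (circ_continuous_cst _) cc.
- move=> t t1; have t0 := norm1_neq0 t1; have tz := norm1_sub_neq0 t1 z1.
  by rewrite exprS; field; rewrite t0 tz expf_neq0.
Qed.

(** Since conj t = 1/t on the circle, conj q(t) is a combination of the t^-k; this converts the
    orthogonality hypothesis into the form used by the Toeplitz functional. *)
Lemma mu_integral_moment p q : weight_integrable lam eta ->
  mu_integral (circle_weight b) (fun z => p.[z] * (q.[z])^*) =
  \sum_(k < size q) (q`_k)^* * moment lam eta p k.
Proof.
move=> wI; rewrite mu_integral_weighted; last first.
  apply: circ_continuousM (circ_continuous_horner p) _.
  exact: circ_continuous_conj (circ_continuous_horner q).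
have cm k : circ_continuous (fun t => (q`_k)^* * (p.[t] / t ^+ k)).
  exact: circ_continuousM (circ_continuous_cst _) (circ_continuous_moment p k).
transitivity (\sum_(k < size q) weighted_integral lam eta (fun t => (q`_k)^* * (p.[t] / t ^+ k))).
  rewrite -(weighted_sum wI _ cm); apply: eq_weighted => t t1.
  have tc : t^* = t^-1 by rewrite invC_norm t1 expr1n invr1 mul1r.
  rewrite (horner_coef q) rmorph_sum mulr_sumr; apply: eq_bigr => k _.
  by rewrite rmorphM rmorphXn/= tc exprVn mulrCA.
by apply: eq_bigr => k _; rewrite (weightedZ wI)//; exact: circ_continuous_moment.
Qed.

End CauchyTransform.

Theorem mainTheorem11 (R : realType) (lambda eta : R)
    (b : R[i]) (Phi : nat -> {poly R[i]}) (kappa : nat -> R) :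
  - (1 / 2) < lambda ->
  b = (lambda +i* eta)%C ->
  monic_orthogonal (circle_weight b) Phi kappa ->
  forall n : nat, (1 <= n)%N ->
  let alpha := verblunsky Phi (n - 1) in
  let Phin := Phi n in
  let Phis := reversed_poly (n - 1) (Phi (n - 1)%N) in
  let Gn : (R[i])^o -> (R[i])^o := G_fun (circle_weight b) Phi n in
  let Gs : (R[i])^o -> (R[i])^o := Gstar_fun (circle_weight b) Phi (n - 1) in
  [/\ forall z : R[i],
        z * (1 - z) * Phin^`().[z]
        = (- n%:R * z + (b^* + n%:R) * (1 - `|alpha| ^+ 2)) * Phin.[z]
          + (b^* + n%:R) * (1 - `|alpha| ^+ 2) * alpha^* * Phis.[z],
      forall z : R[i], `|z| != 1 ->
        derivable Gn z 1 /\
        z * (1 - z) * 'D_1 Gn z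
        = (- b * z - (b^* + n%:R) * `|alpha| ^+ 2) * Gn z
          + (b^* + n%:R) * (1 - `|alpha| ^+ 2) * alpha^* * Gs z,
      forall z : R[i],
        z * (1 - z) * Phis^`().[z]
        = (b * z + (b^* + n%:R) * `|alpha| ^+ 2) * Phis.[z]
          + (b^* + n%:R) * alpha * Phin.[z] &
      forall z : R[i], `|z| != 1 ->
        derivable Gs z 1 /\
        z * (1 - z) * 'D_1 Gs z
        = (n%:R * z - (b^* + n%:R) * (1 - `|alpha| ^+ 2)) * Gs z
          + (b^* + n%:R) * alpha * Gn z].
Proof.
move=> lgt -> [mPhi sPhi k0 oPhi] [//|m] _; rewrite subSS subn0.
move=> alpha Phin Phis Gn Gs.
have Phi0 : Phi 0 = 1.
  have /size_poly1P[c _ cE] : size (Phi 0) == 1 by rewrite sPhi.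
  by have := mPhi 0; rewrite cE monicE lead_coefC => /eqP ->.
pose N n : R[i] := (kappa n ^- 2)%:C%C.
have N0 n : N n != 0 by apply/eqP => -[] /eqP; rewrite invr_eq0 expf_eq0/= gt_eqF.
have Nc n : (N n)^* = N n by exact: conjc_real.
(* As Phi 0 = 1, the total mass is <Phi 0, Phi 0> = kappa_0^-2, a nonzero number, which excludes the
   default value of a divergent integral. *)
have wI : weight_integrable lambda eta.
  apply: weight_integrable_of_mass; rewrite -mu_integral_weighted; last exact: circ_continuous_cst.
  have := oPhi 0%N 0%N; rewrite eqxx Phi0 -/(N 0%N) => e.
  suff -> : mu_integral (circle_weight (lambda +i* eta)%C) (fun=> 1) = N 0%N by [].
  by rewrite -e; congr (mu_integral _); apply/funext => z; rewrite hornerC conjC1 mulr1.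
pose ip := moment lambda eta.
have ipD := momentD wI; have ipZ := momentZ wI; have ipX := @momentX _ lambda eta.
have ipC := moment_conj wI; have ipP := moment_pearson wI lgt.
have orth n k : \sum_(j < k.+1) ((Phi k)`_j)^* * ip (Phi n) j = if n == k then N n else 0.
  by rewrite -oPhi mu_integral_moment// sPhi.
have sysPhi := deriv_Phi_system ipD ipZ ipX ipC mPhi sPhi N0 Nc orth ipP m.
have sysPhis := deriv_reversed_system ipD ipZ ipX ipC mPhi sPhi N0 Nc orth ipP m.
have ipPhi : ip Phin m = 0 by exact: (ip_Phi0 mPhi sPhi orth (ltnSn m)).
(* The free term in the second transform: b from moving z out of the transform and m - b from
   Pearson's identity add up to m. At m = 0 the pairing is nonzero, so the factor is essential. *)
have ipPhis : m%:R * ip Phis m = 0.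
  rewrite /ip /Phis; case: (m) => [|j]; first by rewrite mul0r.
  by rewrite (ip_reversed0 ipD ipZ ipX ipC mPhi sPhi orth) ?mulr0//= leqnn.
rewrite -/alpha -/Phin -/Phis in sysPhi sysPhis.
have GE p z : `|z| != 1 -> cauchy_transform (circle_weight (lambda +i* eta)%C) p m.+1 z =
  (2 * pi%:C%C)^-1 * cauchy lambda eta p m z by exact: cauchy_transformE.
have dG p z (z1 : `|z| != 1) := is_derive_cauchy
  (f := cauchy_transform (circle_weight (lambda +i* eta)%C) p m.+1) wI z1 (GE p).
split.
- move=> z; have /(congr1 (horner^~ z)) := sysPhi.
  rewrite !(hornerM, hornerD, hornerN, hornerX, hornerZ, hornerC) => e.
  by rewrite -mulrA e; ring.
- move=> z z1; have [d1 d2] := dG Phin z z1; split; first exact: d1.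
  rewrite [X in _ * X = _]d2 /Gn /Gs /G_fun /Gstar_fun !GE//.
  rewrite mulrCA cauchy_pearson// sysPhi !cauchyD// !cauchyZ// cauchyX//.
  by rewrite -/ip ipPhi; ring.
- move=> z; have /(congr1 (horner^~ z)) := sysPhis.
  rewrite !(hornerM, hornerD, hornerN, hornerX, hornerZ, hornerC) => e.
  by rewrite -mulrA e; ring.
- move=> z z1; have [d1 d2] := dG Phis z z1; split; first exact: d1.
  rewrite [X in _ * X = _]d2 /Gn /Gs /G_fun /Gstar_fun !GE//.
  rewrite mulrCA cauchy_pearson// sysPhis !cauchyD// !cauchyZ// cauchyX//.
  rewrite -/ip -/Phin -/Phis.
  apply: subr0_eq; transitivity ((2 * pi%:C%C)^-1 * (m%:R * ip Phis m)); last first.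
    by rewrite ipPhis mulr0.
  by ring.
Qed.
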